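(* For all ordered forests $F,G$, let $S(F,G)$ be the set of bijections $f:V(F)\to V(G)$ such that for all $x,y\in V(F)$: $$(x\twoheadrightarrow y \text{ in } F)\Longrightarrow f(x)\ge f(y),\qquad (f(x)\twoheadrightarrow f(y)\text{ in }G)\Longrightarrow x\ge y.$$ Define a pairing on $\mathbf{H}_o^{cop}$ by $\langle F,G\rangle=|S(F,G)|$ for all ordered forests $F,G$, extended bilinearly. This pairing is a Hopf pairing, is symmetric, and is homogeneous of degree $0$.
   Context: $K$ is a commutative field. A rooted forest is a finite graph $F$ whose connected components are rooted trees (finite trees with a distinguished vertex, the root); $V(F)$ is its vertex set. Edges are oriented from leaves to roots, and $v\twoheadrightarrow w$ means there is an oriented path from $v$ to $w$ (with $v\twoheadrightarrow v$). An ordered forest is a rooted forest with a total order on its vertices (up to isomorphism). $\mathbf{H}_o$ is the $K$-vector space with basis the ordered forests, graded by number of vertices. The product $FG$ is the disjoint union, keeping the orders of $F$ and $G$ and with every vertex of $F$ smaller than every vertex of $G$; the unit is the empty forest $1$. A subset $\boldsymbol v\subseteq V(F)$ is an admissible cut, written $\boldsymbol v\models V(F)$, if there are no two distinct $v,w\in\boldsymbol v$ with $v\twoheadrightarrow w$; $Lea_{\boldsymbol v}F$ is the sub-forest on $\{w:\exists v\in\boldsymbol v,\ w\twoheadrightarrow v\}$ and $Roo_{\boldsymbol v}F$ the sub-forest on the other vertices (with induced orders). The coproduct is $\Delta(F)=\sum_{\boldsymbol v\models V(F)}Lea_{\boldsymbol v}F\otimes Roo_{\boldsymbol v}F$. $\mathbf{H}_o$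 is a graded Hopf algebra; $\mathbf{H}_o^{cop}$ is the same algebra with the opposite coproduct $\Delta^{op}$. A Hopf pairing on a Hopf algebra $(H,\Delta,\varepsilon)$ is a bilinear form with $\langle xy,z\rangle=\langle x\otimes y,\Delta(z)\rangle$, $\langle x,yz\rangle=\langle\Delta(x),y\otimes z\rangle$, $\langle1,x\rangle=\langle x,1\rangle=\varepsilon(x)$, where $\langle a\otimes b,c\otimes d\rangle=\langle a,c\rangle\langle b,d\rangle$; here $\Delta$ is replaced by $\Delta^{op}$. The pairing is homogeneous of degree $0$ if $\langle x,y\rangle=0$ for homogeneous $x,y$ of different degrees. *)

(* Defs.v *)
(* {malg K[M]} is the monoid algebra of M over K, from the multinomials library. *)
From HB Require Import structures.
From mathcomp Require Import all_boot all_order all_algebra.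
From mathcomp Require Import finmap monalg.

Set Implicit Arguments.
Unset Strict Implicit.
Unset Printing Implicit Defensive.

Import GRing.Theory.
Local Open Scope ring_scope.

(* A rooted forest on the vertices 0, ..., n-1 is encoded by its parent
   function: [p v = Some w] is the edge v -> w oriented towards the root, and
   [p v = None] says that v is a root.  A parent function describes a rooted
   forest exactly when it has no oriented cycle. *)
Section Forest.
Variable n : nat.
Implicit Types p : {ffun 'I_n -> option 'I_n}.

Definition edge p : rel 'I_n := fun v w => p v == Some w.

Definition acyclic p : bool :=
  [forall v, forall w, edge p v w ==> ~~ connect (edge p) w v].

Record forest := Forest {
  parent :> {ffun 'I_n -> option 'I_n};
  forestP : acyclic parent
}.

HB.instance Definition _ := [isSub for parent].
HB.instance Definition _ := [Choice of forest by <:].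

(* v ->> w: oriented path from v to w *)
Definition reach (F : forest) : rel 'I_n := connect (edge F).

End Forest.

(* A totally ordered finite set of n elements is uniquely isomorphic to 'I_n
   with its usual order, so that an isomorphism class of ordered forests is a
   forest on some 'I_n. *)
Definition ordered_forest := {n : nat & forest n}.
HB.instance Definition _ := Choice.on ordered_forest.

Definition degree (F : ordered_forest) : nat := tag F.
Definition forest_of (F : ordered_forest) : forest (degree F) := tagged F.
Coercion forest_of : ordered_forest >-> forest.

Section Subforest.
Variables (n : nat) (F : forest n) (A : {set 'I_n}).

(* [enum_val : 'I_#|A| -> 'I_n] is the increasing enumeration of A. *)
Definition sub_parent : {ffun 'I_#|A| -> option 'I_#|A|} :=
  [ffun i => [pick j | edge F (enum_val i) (enum_val j)]].

Lemma sub_acyclic : acyclic sub_parent.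
Proof.
have sub_edge i j : edge sub_parent i j -> edge F (enum_val i) (enum_val j).
  by rewrite {1}/edge ffunE; case: pickP => // k ? /eqP[<-].
apply/forallP => i; apply/forallP => j; apply/implyP => /sub_edge ij.
have := forestP F => /forallP/(_ (enum_val i))/forallP/(_ (enum_val j)).
rewrite ij; apply: contra => /connectP[s js ->]; apply/connectP.
exists (map enum_val s); last by rewrite last_map.
by apply: (homo_path sub_edge).
Qed.

Definition subforest : ordered_forest := Tagged forest (Forest sub_acyclic).

End Subforest.

Section DisjointUnion.
Variables (m n : nat) (F : forest m) (G : forest n).

Definition union_parent : {ffun 'I_(m + n) -> option 'I_(m + n)} :=
  [ffun i => match split i with
             | inl v => omap (@lshift m n) (F v)
             | inr v => omap (@rshift m n) (G v)
             end].

Lemma union_parentl v :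
  union_parent (lshift n v) = omap (@lshift m n) (F v).
Proof. by rewrite ffunE (unsplitK (inl v)). Qed.

Lemma union_parentr v :
  union_parent (rshift m v) = omap (@rshift m n) (G v).
Proof. by rewrite ffunE (unsplitK (inr v)). Qed.

Lemma union_acyclic : acyclic union_parent.
Proof.
have edgel v y : edge union_parent (lshift n v) y ->
    exists2 w, y = lshift n w & edge F v w.
  rewrite /edge union_parentl; case: (F v) => //= w /eqP[<-].
  by exists w.
have edger v y : edge union_parent (rshift m v) y ->
    exists2 w, y = rshift m w & edge G v w.
  rewrite /edge union_parentr; case: (G v) => //= w /eqP[<-].
  by exists w.
have conl v y : connect (edge union_parent) (lshift n v) y ->
    exists2 w, y = lshift n w & connect (edge F) v w.
  case/connectP=> s; elim: s v => [|z s IH] v /=.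
    by move=> _ ->; exists v.
  case/andP=> /edgel[w -> vw] /IH{}IH /IH[u -> wu].
  by exists u => //; apply: connect_trans wu; apply: connect1.
have conr v y : connect (edge union_parent) (rshift m v) y ->
    exists2 w, y = rshift m w & connect (edge G) v w.
  case/connectP=> s; elim: s v => [|z s IH] v /=.
    by move=> _ ->; exists v.
  case/andP=> /edger[w -> vw] /IH{}IH /IH[u -> wu].
  by exists u => //; apply: connect_trans wu; apply: connect1.
apply/forallP => x; apply/forallP => y; apply/implyP.
rewrite -(splitK x); case: (split x) => v /=.
- case/edgel=> w -> vw; apply/negP => /conl[u /lshift_inj <-].
  by have /forallP/(_ v)/forallP/(_ w) := forestP F; rewrite vw => /negP.
- case/edger=> w -> vw; apply/negP => /conr[u /rshift_inj <-].
  by have /forallP/(_ v)/forallP/(_ w) := forestP G; rewrite vw => /negP.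
Qed.

Definition union_forest : forest (m + n) := Forest union_acyclic.

End DisjointUnion.

(* every vertex of F is smaller than every vertex of G *)
Definition forest_mul (F G : ordered_forest) : ordered_forest :=
  Tagged forest (union_forest F G).

Lemma empty_acyclic : acyclic ([ffun=> None] : {ffun 'I_0 -> option 'I_0}).
Proof. by apply/forallP => -[]. Qed.

Definition forest_one : ordered_forest :=
  Tagged forest (Forest empty_acyclic).

Section ForestMonoid.

Lemma ordered_forest_eq (F G : ordered_forest) (e : degree F = degree G) :
  (forall i, omap val (F i) = omap val (G (cast_ord e i))) -> F = G.
Proof.
case: F G e => m F [n G]; rewrite /degree /= => e; case: _ / e G => G FG.
congr Tagged; apply/val_inj/ffunP => i; move: (FG i); rewrite cast_ord_id /=.
by case: (F i) (G i) => [a|] [b|] //= [/val_inj->].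
Qed.

Lemma forest_mul_parent (F G : ordered_forest) (i : 'I_(degree F + degree G)) :
  omap val (forest_mul F G i) =
  match split i with
  | inl v => omap val (F v)
  | inr v => omap (fun w : 'I__ => (degree F + w)%N) (G v)
  end.
Proof. by rewrite ffunE; case: splitP => v _; case: (_ v). Qed.

Lemma forest_mul_valE (F G : ordered_forest) (i : 'I_(degree F + degree G)) :
  (forall v : 'I_(degree F), val i = v ->
    omap val (forest_mul F G i) = omap val (F v)) /\
  (forall v : 'I_(degree G), val i = (degree F + v)%N ->
    omap val (forest_mul F G i) = omap (addn (degree F)) (omap val (G v))).
Proof.
split=> v iv.
  have -> : i = lshift _ v by apply/val_inj.
  by rewrite forest_mul_parent (unsplitK (inl v)).
have -> : i = rshift _ v by apply/val_inj.
by rewrite forest_mul_parent (unsplitK (inr v)); case: (G v).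
Qed.

Lemma forest_mulA : associative forest_mul.
Proof.
move=> F G H; have e : degree (forest_mul F (forest_mul G H)) =
  degree (forest_mul (forest_mul F G) H) by rewrite /degree /= addnA.
apply: (ordered_forest_eq (e := e)) => i.
have [iF iGH] := forest_mul_valE i.
have [jFG jH] := forest_mul_valE (cast_ord e i).
case: (split_ordP i) => [v iv | w iw].
  have iv' : val i = v by rewrite iv.
  rewrite (iF _ iv') (jFG (lshift _ v)) //.
  by rewrite ((forest_mul_valE _).1 v).
have iw' : val i = (degree F + w)%N by rewrite iw.
rewrite (iGH _ iw').
case: (split_ordP w) => [v wv | v wv].
  have wv' : val w = v by rewrite wv.
  rewrite ((forest_mul_valE w).1 _ wv').
  rewrite (jFG (rshift _ v)) /= ?iw' ?wv' //.
  by rewrite ((forest_mul_valE _).2 v).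
have wv' : val w = (degree G + v)%N by rewrite wv.
rewrite ((forest_mul_valE w).2 _ wv') (jH v) /= ?iw' ?wv' ?addnA //.
by case: (H v) => //= a; rewrite addnA.
Qed.

Lemma forest_mul1m : left_id forest_one forest_mul.
Proof.
move=> F; apply: (@ordered_forest_eq (forest_mul forest_one F) F erefl) => i.
rewrite ((forest_mul_valE i).2 (cast_ord erefl i)) //.
by case: (F _).
Qed.

Lemma forest_mulm1 : right_id forest_one forest_mul.
Proof.
move=> F; have e : degree (forest_mul F forest_one) = degree F.
  by rewrite /degree /= addn0.
apply: (ordered_forest_eq (e := e)) => i.
by rewrite ((forest_mul_valE i).1 (cast_ord e i)).
Qed.

Lemma degree_eq0 (F : ordered_forest) : degree F = 0%N -> F = forest_one.
Proof.
move=> F0; apply: (@ordered_forest_eq F forest_one F0) => i.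
by case: (cast_ord F0 i).
Qed.

Lemma forest_unitm F G :
  forest_mul F G = forest_one -> F = forest_one /\ G = forest_one.
Proof.
move/(congr1 degree)/eqP; rewrite addn_eq0 => /andP[/eqP F0 /eqP G0].
by split; apply: degree_eq0.
Qed.

End ForestMonoid.

HB.instance Definition _ := Choice_isMonomialDef.Build ordered_forest
  forest_mulA forest_mul1m forest_mulm1 forest_unitm.

Section Cuts.
Variables (n : nat) (F : forest n).
Implicit Types c : {set 'I_n}.

Definition admissible c : bool :=
  [forall v in c, forall w in c, (v != w) ==> ~~ reach F v w].

Definition leaves_part c : {set 'I_n} := [set w | [exists v in c, reach F w v]].

Definition Lea c : ordered_forest := subforest F (leaves_part c).
Definition Roo c : ordered_forest := subforest F (~: leaves_part c).

End Cuts.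

(* For the free module H = {malg K[B]} on a basis B, the tensor square of H is
   the free module {malg K[B * B]}, where (a, b) stands for a (x) b. *)
Section TensorSquare.
Variables (K : fieldType) (B : choiceType).
Local Notation H := {malg K[B]}.
Local Notation H2 := {malg K[(B * B)%type]}.

Definition tens (x y : H) : H2 :=
  \sum_(a <- msupp x) \sum_(b <- msupp y) << x@_a * y@_b *g (a, b) >>.

Definition tens_swap (u : H2) : H2 :=
  \sum_(ab <- msupp u) << u@_ab *g (ab.2, ab.1) >>.

(* <a (x) b, c (x) d> = <a, c> <b, d> on basis elements, extended bilinearly *)
Definition tens_pairing (p : H -> H -> K) (u v : H2) : K :=
  \sum_(ab <- msupp u) \sum_(cd <- msupp v)
     u@_ab * v@_cd * (p << ab.1 >> << cd.1 >> * p << ab.2 >> << cd.2 >>).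

Definition bilinear_form (p : H -> H -> K) : Prop :=
  (forall x, scalar (p x)) /\ (forall y, scalar (p^~ y)).

Definition symmetric_pairing (p : H -> H -> K) : Prop :=
  forall x y, p x y = p y x.

Definition homogeneous (deg : B -> nat) (d : nat) (x : H) : Prop :=
  forall b, b \in msupp x -> deg b = d.

Definition homogeneous_degree0 (deg : B -> nat) (p : H -> H -> K) : Prop :=
  forall d e x y, homogeneous deg d x -> homogeneous deg e y ->
  d <> e -> p x y = 0.

End TensorSquare.

Definition hopf_pairing (K : fieldType) (B : monomType)
    (Delta : {malg K[B]} -> {malg K[(B * B)%type]}) (eps : {malg K[B]} -> K)
    (p : {malg K[B]} -> {malg K[B]} -> K) : Prop :=
  [/\ bilinear_form p,
      forall x y z, p (x * y) z = tens_pairing p (tens x y) (Delta z),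
      forall x y z, p x (y * z) = tens_pairing p (Delta x) (tens y z) &
      forall x, p 1 x = eps x /\ p x 1 = eps x].

Section OrderedForests.
Variable K : fieldType.

(* As a monoid algebra, Ho carries the product of ordered forests. *)
Definition Ho := {malg K[ordered_forest]}.
Definition Ho2 := {malg K[(ordered_forest * ordered_forest)%type]}.

Definition coprod_forest (F : ordered_forest) : Ho2 :=
  \sum_(c : {set 'I_(degree F)} | admissible F c) << (Lea F c, Roo F c) >>.

Definition coprod (x : Ho) : Ho2 :=
  \sum_(F <- msupp x) x@_F *: coprod_forest F.

Definition coprod_op (x : Ho) : Ho2 := tens_swap (coprod x).

(* the counit, shared by Ho and Ho^cop: the coefficient of the empty forest *)
Definition counit (x : Ho) : K := x@_(mone : ordered_forest).

Definition forest_bij (F G : ordered_forest) :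
    {set {ffun 'I_(degree F) -> 'I_(degree G)}} :=
  [set f : {ffun 'I_(degree F) -> 'I_(degree G)} |
    [&& injectiveb f, [forall z, z \in codom f] &
     [forall x, forall y,
       (reach F x y ==> (f y <= f x)%N) &&
       (reach G (f x) (f y) ==> (y <= x)%N)]]].

Definition pairing (x y : Ho) : K :=
  \sum_(F <- msupp x) \sum_(G <- msupp y) x@_F * y@_G * (#|forest_bij F G|)%:R.

End OrderedForests.

(* Main.v *)
(* An element of S(F1 F2, G) maps the vertices of F2 onto a subset of V(G) that
   is closed towards the leaves, because those vertices exceed the ones of F1.
   Such subsets are exactly the leaf parts of the admissible cuts of G, the cut
   being recovered as the set of maximal elements.  Cutting the bijection there
   gives <F1 F2, G> = sum_c <F1, Roo_c G> <F2, Lea_c G>, the first Hopf axiom for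
   the opposite coproduct.  Inverting bijections gives symmetry, which turns the
   first axiom into the second. *)
From HB Require Import structures.
Require Import Defs.
From mathcomp Require Import all_boot all_order all_algebra.
From mathcomp Require Import finmap monalg.

Set Implicit Arguments.
Unset Strict Implicit.
Unset Printing Implicit Defensive.

Import GRing.Theory.

(** * Reflexive transitive closures and increasing enumerations *)

Lemma connect_min (T : finType) (e r : rel T) :
  reflexive r -> transitive r -> subrel e r -> subrel (connect e) r.
Proof.
move=> rr rt er x y /connectP[s xs ->].
elim: s x xs => [|z s IH] x //= /andP[/er xz /IH].
exact: rt.
Qed.

Lemma homo_connect (T T' : finType) (e : rel T) (e' : rel T') (h : T -> T') :
  {homo h : x y / e x y >-> e' x y} ->
  {homo h : x y / connect e x y >-> connect e' x y}.
Proof.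
move=> hom x y; apply: (connect_min (r := fun x y => connect e' (h x) (h y))).
- by move=> z; apply: connect0.
- by move=> y' x' z'; apply: connect_trans.
- by move=> x' y' /hom; apply: connect1.
Qed.

(** [enum A] is a subsequence of the increasing enumeration of ['I_n]. Order conditions on a
    subforest can thus be tested in the ambient forest. *)
Lemma leq_enum_val n (A : {set 'I_n}) (i j : 'I_#|A|) :
  (enum_val i <= enum_val j)%N = (i <= j)%N.
Proof.
have sA : sorted ltn (map val (enum A)).
  have -> : enum A = filter (mem A) (enum 'I_n) by rewrite [enum 'I_n]enumT.
  apply: (subseq_sorted ltn_trans (map_subseq val (filter_subseq _ _))).
  by rewrite val_enum_ord iota_ltn_sorted.
have homo_lt (k l : 'I_#|A|) : (k < l)%N -> (enum_val k < enum_val l)%N.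
  move=> kl.
  have eE (m : 'I_#|A|) : val (enum_val m) = nth 0 (map val (enum A)) m.
    by rewrite (nth_map (enum_val i)) -?cardE // -enum_val_nth.
  rewrite !eE; apply: (sorted_ltn_nth ltn_trans) => //;
  by rewrite inE size_map -cardE.
case: (ltngtP i j) => [/homo_lt/ltnW //|/homo_lt|/val_inj ->].
  by rewrite ltnNge => /negbTE.
exact: leqnn.
Qed.

(** * Oriented paths and admissible cuts in one forest *)

Section Reach.
Variables (n : nat) (F : forest n).
Implicit Types (v w : 'I_n) (A c : {set 'I_n}).

Lemma reach_refl v : reach F v v.
Proof. exact: connect0. Qed.

Lemma reach_trans : transitive (reach F).
Proof. exact: connect_trans. Qed.

(** A path back to [v] after a first edge from [v] to [z] would close a cycle. *)
Lemma reach_anti : antisymmetric (reach F).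
Proof.
move=> v w /andP[/connectP[[|z s] /=]]; first by move=> _ ->.
case/andP=> vz zs wE wv.
have /forallP/(_ v)/forallP/(_ z) := forestP F; rewrite vz /= => /negP[].
by apply: connect_trans wv; apply/connectP; exists s.
Qed.

(** Convexity of [A] keeps every intermediate vertex of a path inside [A], so each of its edges
    survives in the subforest. *)
Lemma reach_subforest A (i j : 'I_#|A|) :
  (forall u v w, u \in A -> w \in A -> reach F u v -> reach F v w -> v \in A) ->
  reach (subforest F A) i j = reach F (enum_val i) (enum_val j).
Proof.
move=> convA; apply/idP/idP.
  apply: homo_connect => {}i {}j; rewrite {1}/edge ffunE.
  by case: pickP => // k ? /eqP[<-].
case/connectP=> s; elim: s i => [|z s IH] i /=.
  by move=> _ /enum_val_inj ->; apply: connect0.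
case/andP=> iz zs jE.
have zA : z \in A.
  apply: convA (enum_valP i) (enum_valP j) (connect1 iz) _.
  by apply/connectP; exists s.
have zE := enum_rankK_in zA zA.
rewrite -zE in iz zs jE.
apply: connect_trans (IH _ zs jE); apply: connect1.
(* [sub_parent] picks some parent in [A]; a vertex has at most one parent, so the choice can only be
   [z]. *)
rewrite /edge ffunE; case: pickP => [k|/(_ (enum_rank_in zA z))]; last first.
  by rewrite iz.
rewrite /edge in iz *; rewrite (eqP iz) => /eqP[/enum_val_inj ->].
by rewrite eqxx.
Qed.

Definition leaf_closed A := forall v w, w \in A -> reach F v w -> v \in A.

Definition tops A : {set 'I_n} :=
  [set v in A | [forall w in A, reach F v w ==> (w == v)]].

Lemma leaves_part_closed c : leaf_closed (leaves_part F c).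
Proof.
move=> v w; rewrite !inE => /exists_inP[u uc wu] vw.
by apply/exists_inP; exists u => //; apply: reach_trans wu.
Qed.

Lemma admissible_tops A : admissible F (tops A).
Proof.
apply/forall_inP => v /[!inE] /andP[_ /forall_inP vtop].
apply/forall_inP => w /[!inE] /andP[/vtop wA _].
by rewrite implybNN eq_sym.
Qed.

Lemma topsK A : leaf_closed A -> leaves_part F (tops A) = A.
Proof.
move=> closedA; apply/setP => w; rewrite inE; apply/exists_inP/idP.
  by case=> v; rewrite inE => /andP[vA _]; apply: closedA.
move=> wA.
pose P v := (v \in A) && reach F w v.
have Pw : P w by rewrite /P wA reach_refl.
(* Among the vertices of [A] reached from [w], [v] reaches the fewest vertices. If [v] reaches [u]
   in [A], then [u] reaches no more than [v] does, and minimality makes the two sets equal; so [u]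
   reaches [v] and antisymmetry gives [u = v]. *)
case: (arg_minnP (fun v => #|reach F v|) Pw) => v /andP[vA wv] vmin.
exists v => //; rewrite inE vA; apply/forall_inP => u uA; apply/implyP => vu.
have sub : reach F u \subset reach F v.
  by apply/subsetP => z; apply: reach_trans.
have := vmin u; rewrite /P uA (reach_trans wv vu) => /(_ isT) le_vu.
have /subset_cardP/(_ sub) : #|reach F u| = #|reach F v|.
  by apply/eqP; rewrite eqn_leq subset_leq_card.
move=> eq_uv; have uv : reach F u v := etrans (eq_uv v) (reach_refl v).
by apply/eqP/reach_anti; rewrite uv vu.
Qed.

(** A path from [v] in [c] to a vertex of the leaf part continues to some [u] in [c]. Admissibility
    forces [u = v], and antisymmetry then collapses the path, so [v] is maximal. *)
Lemma leaves_partK c : admissible F c -> tops (leaves_part F c) = c.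
Proof.
move=> /forall_inP adm; apply/setP => v; rewrite !inE; apply/idP/idP.
  case/andP=> /exists_inP[u uc vu] /forall_inP/(_ u).
  rewrite inE vu /= => top; have /eqP <- // : u == v.
  by apply: top; apply/exists_inP; exists u => //; apply: reach_refl.
move=> vc; apply/andP; split.
  by apply/exists_inP; exists v => //; apply: reach_refl.
apply/forall_inP => w /[!inE] /exists_inP[u uc wu]; apply/implyP => vw.
have /forall_inP/(_ u uc) := adm v vc.
rewrite (reach_trans vw wu) implybF negbK => /eqP vu.
by apply/eqP/reach_anti; rewrite vw vu wu.
Qed.

End Reach.

(** * Oriented paths in a disjoint union *)

Section ReachUnion.
Variables (F G : ordered_forest).
Local Notation m := (degree F).
Local Notation n := (degree G).

Lemma reach_mul (x y : 'I_(m + n)) : reach (forest_mul F G) x y =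
  match split x, split y with
  | inl v, inl w => reach F v w
  | inr v, inr w => reach G v w
  | _, _ => false
  end.
Proof.
apply/idP/idP.
  (* The right-hand side is a reflexive transitive relation containing the edges of the union, hence
     it contains the paths. *)
  move: x y; apply: connect_min => [x|y x z|x y].
  - by case: (split x) => v; apply: reach_refl.
  - case: (split x) (split y) (split z) => ? [] ? [] ? //; exact: reach_trans.
  rewrite /edge; case: (split_ordP x) => v ->.
    rewrite [_ _ (lshift _ v)]union_parentl; case E: (F v) => [w|] //= /eqP[<-].
    by rewrite (unsplitK (inl w)); apply: connect1; rewrite /edge E.
  rewrite [_ _ (rshift _ v)]union_parentr; case E: (G v) => [w|] //= /eqP[<-].
  by rewrite (unsplitK (inr w)); apply: connect1; rewrite /edge E.
case: (split_ordP x) => v ->; case: (split_ordP y) => w -> //.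
  apply: homo_connect => {}v {}w /eqP vw.
  by rewrite /edge [_ _ (lshift _ v)]union_parentl vw.
apply: homo_connect => {}v {}w /eqP vw.
by rewrite /edge [_ _ (rshift _ v)]union_parentr vw.
Qed.

Lemma reach_mull (v w : 'I_m) :
  reach (forest_mul F G) (lshift n v) (lshift n w) = reach F v w.
Proof. by rewrite reach_mul !(unsplitK (inl _)). Qed.

Lemma reach_mulr (v w : 'I_n) :
  reach (forest_mul F G) (rshift m v) (rshift m w) = reach G v w.
Proof. by rewrite reach_mul !(unsplitK (inr _)). Qed.

Lemma reach_mullr (v : 'I_m) (w : 'I_n) :
  reach (forest_mul F G) (lshift n v) (rshift m w) = false.
Proof. by rewrite reach_mul (unsplitK (inl _)) (unsplitK (inr _)). Qed.

Lemma reach_mulrl (v : 'I_m) (w : 'I_n) :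
  reach (forest_mul F G) (rshift m w) (lshift n v) = false.
Proof. by rewrite reach_mul (unsplitK (inl _)) (unsplitK (inr _)). Qed.

End ReachUnion.

(** * Order-compatible bijections and their inverses *)

Lemma forest_bijP (F G : ordered_forest)
    (f : {ffun 'I_(degree F) -> 'I_(degree G)}) :
  reflect [/\ injective f, forall z, exists x, z = f x,
     forall x y, reach F x y -> (f y <= f x)%N &
     forall x y, reach G (f x) (f y) -> (y <= x)%N]
  (f \in forest_bij F G).
Proof.
rewrite inE; apply: (iffP and3P).
  case=> /injectiveP injf /forallP surjf /forallP homf; split=> //.
  - by move=> z; have /codomP := surjf z.
  - by move=> x y xy; have /forallP/(_ y)/andP[/implyP->] := homf x.
  - by move=> x y xy; have /forallP/(_ y)/andP[_ /implyP->] := homf x.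
case=> injf surjf homF homG; split; first exact/injectiveP.
  by apply/forallP => z; apply/codomP.
apply/forallP => x; apply/forallP => y.
by apply/andP; split; apply/implyP; [apply: homF | apply: homG].
Qed.

(** Inverting a bijection exchanges the two order conditions. One inequality, proved for all pairs
    of forests, gives both. *)
Lemma card_forest_bijC (F G : ordered_forest) :
  #|forest_bij F G| = #|forest_bij G F|.
Proof.
suff le_card F' G' : #|forest_bij F' G'| <= #|forest_bij G' F'|.
  by apply/eqP; rewrite eqn_leq !le_card.
(* [inv f] takes values in an option type so as to be defined for every [f],
   even when [F'] is empty. *)
pose inv (f : {ffun 'I_(degree F') -> 'I_(degree G')}) :
    {ffun 'I_(degree G') -> option 'I_(degree F')} :=
  [ffun z => [pick x | f x == z]].
pose some (g : {ffun 'I_(degree G') -> 'I_(degree F')}) :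
    {ffun 'I_(degree G') -> option 'I_(degree F')} := [ffun z => Some (g z)].
have some_inj : injective some.
  move=> g h /ffunP gh; apply/ffunP => z.
  by have := gh z; rewrite !ffunE => -[].
have invE (f : {ffun 'I_(degree F') -> 'I_(degree G')}) x :
      injective f -> inv f (f x) = Some x.
  move=> injf; rewrite ffunE; case: pickP => [y /eqP/injf -> //|/(_ x)].
  by rewrite eqxx.
have inv_inj : {in forest_bij F' G' &, injective inv}.
  move=> f g /forest_bijP[injf _ _ _] /forest_bijP[injg surjg _ _] /ffunP fg.
  apply/ffunP => x; have [y fxE] := surjg (f x).
  by have := fg (f x); rewrite invE // fxE invE // => -[->].
(* Both sets embed into option-valued functions, through [inv] and [some]; it remains to include the
   first image in the second. *)
rewrite -(card_in_imset inv_inj) -(card_imset _ some_inj) subset_leq_card //.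
apply/subsetP => _ /imsetP[f /forest_bijP[injf surjf homF homG] ->].
have [g gK] := fin_all_exists surjf.
have fK x : g (f x) = x by apply: injf; rewrite -gK.
apply/imsetP; exists (finfun g); last first.
  by apply/ffunP => z; rewrite {1}(gK z) invE // ffunE ffunE.
apply/forest_bijP; split.
- by move=> z z'; rewrite !ffunE => zz'; rewrite (gK z) zz' -gK.
- by move=> x; exists (f x); rewrite ffunE fK.
- by move=> z z'; rewrite !ffunE {1}(gK z) {1}(gK z') => /homG.
- by move=> z z'; rewrite !ffunE => /homF; rewrite -!gK.
Qed.

Lemma forest_bij_degree (F G : ordered_forest) f :
  f \in forest_bij F G -> degree F = degree G.
Proof.
case/forest_bijP=> injf surjf _ _.
rewrite -(card_ord (degree F)) -(card_ord (degree G)) -(card_codom injf).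
by apply: eq_card => z; rewrite [RHS]inE; apply/codomP.
Qed.

(** * Cutting a bijection along a leaf part *)

Section CutDecomposition.
Variables F1 F2 G : ordered_forest.
Local Notation m := (degree F1).
Local Notation n := (degree F2).
Local Notation k := (degree G).
Implicit Types (f : {ffun 'I_(m + n) -> 'I_k}) (A : {set 'I_k}).

(* Unification does not find a forest whose degree is [m + n] or [#|A|]. *)
Let mulP := @forest_bijP (forest_mul F1 F2) G.
Let rootP A := @forest_bijP F1 (subforest G (~: A)).
Let leafP A := @forest_bijP F2 (subforest G A).

Definition right_image f : {set 'I_k} := [set f (rshift m w) | w : 'I_n].

Lemma right_image_closed f :
  f \in forest_bij (forest_mul F1 F2) G -> leaf_closed G (right_image f).
Proof.
case/mulP=> _ surjf _ homG v _ /imsetP[w _ ->] vw.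
have [x vE] := surjf v; rewrite {}vE in vw *.
(* If [x] came from a vertex [u] of [F1], [homG] would give [m + w <= u], whereas [u < m]. *)
have := homG _ _ vw; case: (split_ordP x) => u -> /=.
  by rewrite leqNgt ltn_addr.
by move=> _; apply: imset_f.
Qed.

(** The inverse of cutting: [F1] fills the root part and [F2] the leaf part [A]. *)
Definition glue A (g : {ffun 'I_m -> 'I_#|~: A|} * {ffun 'I_n -> 'I_#|A|}) :
    {ffun 'I_(m + n) -> 'I_k} :=
  [ffun x => match split x with
             | inl v => enum_val (g.1 v)
             | inr w => enum_val (g.2 w)
             end].

Lemma gluel A g v : @glue A g (lshift n v) = enum_val (g.1 v).
Proof. by rewrite ffunE (unsplitK (inl v)). Qed.

Lemma gluer A g w : @glue A g (rshift m w) = enum_val (g.2 w).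
Proof. by rewrite ffunE (unsplitK (inr w)). Qed.

Lemma glue_inj A : injective (@glue A).
Proof.
move=> [g1 g2] [h1 h2] /ffunP gh; congr (_, _); apply/ffunP => v.
  by have := gh (lshift n v); rewrite !gluel => /enum_val_inj.
by have := gh (rshift m v); rewrite !gluer => /enum_val_inj.
Qed.

(** A leaf-closed set is convex, and so is its complement, which is the hypothesis of
    [reach_subforest]. *)
Lemma reach_leaf_part A (i j : 'I_#|A|) : leaf_closed G A ->
  reach (subforest G A) i j = reach G (enum_val i) (enum_val j).
Proof.
move=> closedA; apply: reach_subforest => u v w _ wA _.
exact: closedA.
Qed.

Lemma reach_root_part A (i j : 'I_#|~: A|) : leaf_closed G A ->
  reach (subforest G (~: A)) i j = reach G (enum_val i) (enum_val j).
Proof.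
move=> closedA; apply: reach_subforest => u v w.
rewrite !inE => uA _ uv _; apply: contra uA => vA.
exact: closedA uv.
Qed.

(** Inside each half the conditions are those on [g.1] or [g.2]. Across the halves they are
    automatic: the union has no path between [F1] and [F2], closure of [A] forbids paths of [G] from
    the root part into [A], and a path from [A] to the root part only asks that a vertex of [F1]
    precede one of [F2]. *)
Lemma mem_glue A g : leaf_closed G A ->
  (glue g \in forest_bij (forest_mul F1 F2) G) =
  (g.1 \in forest_bij F1 (subforest G (~: A))) &&
  (g.2 \in forest_bij F2 (subforest G A)).
Proof.
case: g => g1 g2 closedA /=.
have disj i j : @enum_val _ [in A] i != @enum_val _ [in ~: A] j.
  apply/eqP => ij; have := enum_valP j; rewrite inE -ij.
  by rewrite (enum_valP i).
apply/idP/andP.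
  case/mulP=> injf surjf homF homG; split; [apply/rootP | apply/leafP]; split.
  - move=> v w vw; apply: (@lshift_inj _ n); apply: injf.
    by rewrite !gluel /= vw.
  - move=> z; have [x] := surjf (enum_val z); case: (split_ordP x) => v ->.
      by rewrite gluel => /enum_val_inj ->; exists v.
    by rewrite gluer => /esym/eqP; rewrite (negPf (disj _ _)).
  - move=> v w vw; rewrite -leq_enum_val.
    have := homF (lshift n v) (lshift n w); rewrite reach_mull !gluel.
    exact.
  - move=> v w; rewrite reach_root_part // => vw.
    by have := homG (lshift n v) (lshift n w); rewrite !gluel; apply.
  - move=> v w vw; apply: (@rshift_inj m); apply: injf.
    by rewrite !gluer /= vw.
  - move=> z; have [x] := surjf (enum_val z); case: (split_ordP x) => v ->.
      by rewrite gluel => /eqP; rewrite (negPf (disj _ _)).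
    by rewrite gluer => /enum_val_inj ->; exists v.
  - move=> v w vw; rewrite -leq_enum_val.
    have := homF (rshift m v) (rshift m w); rewrite reach_mulr !gluer.
    exact.
  - move=> v w; rewrite reach_leaf_part // => vw.
    have := homG (rshift m v) (rshift m w); rewrite !gluer leq_add2l; exact.
case=> /rootP[inj1 surj1 homF1 homG1]
  /leafP[inj2 surj2 homF2 homG2].
apply/mulP; split=> [x y|z|x y|x y].
- case: (split_ordP x) => v ->; case: (split_ordP y) => w ->;
    rewrite ?gluel ?gluer.
  + by move/enum_val_inj/inj1->.
  + by move/esym/eqP; rewrite (negPf (disj _ _)).
  + by move/eqP; rewrite (negPf (disj _ _)).
  + by move/enum_val_inj/inj2->.
- case: (boolP (z \in A)) => zA.
    have [w wE] := surj2 (enum_rank_in zA z); exists (rshift m w).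
    by rewrite gluer /= -wE enum_rankK_in.
  have zA' : z \in ~: A by rewrite inE.
  have [v vE] := surj1 (enum_rank_in zA' z); exists (lshift n v).
  by rewrite gluel /= -vE enum_rankK_in.
- case: (split_ordP x) => v ->; case: (split_ordP y) => w ->;
    rewrite ?gluel ?gluer ?reach_mull ?reach_mulr ?reach_mullr ?reach_mulrl //=.
  + by move/homF1; rewrite leq_enum_val.
  + by move/homF2; rewrite leq_enum_val.
- case: (split_ordP x) => v ->; case: (split_ordP y) => w ->;
    rewrite ?gluel ?gluer /=.
  + by rewrite -reach_root_part // => /homG1.
  + move/(closedA _ _ (enum_valP _)) => vA.
    by have := enum_valP (g1 v); rewrite inE vA.
  + by move=> _; apply: leq_trans (leq_addr _ _); apply: ltnW.
  + by rewrite -reach_leaf_part // leq_add2l => /homG2.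
Qed.

Lemma right_image_glue A g :
  g.2 \in forest_bij F2 (subforest G A) -> right_image (@glue A g) = A.
Proof.
case/leafP=> _ surj2 _ _; apply/setP => z; apply/imsetP/idP.
  by case=> w _ ->; rewrite gluer enum_valP.
move=> zA; have [w wE] := surj2 (enum_rank_in zA z); exists w => //.
by rewrite gluer -wE enum_rankK_in.
Qed.

(** Injectivity keeps the images of the left vertices out of [right_image f], so each half of [f]
    factors through an enumeration. *)
Lemma glue_onto f : injective f -> exists g, f = @glue (right_image f) g.
Proof.
move=> injf.
have left_val v :
    exists j : 'I_#|~: right_image f|, enum_val j = f (lshift n v).
  have vP : f (lshift n v) \in ~: right_image f.
    rewrite inE; apply/imsetP => -[w _ /injf/eqP].
    by rewrite eq_lrshift.
  by exists (enum_rank_in vP (f (lshift n v))); rewrite enum_rankK_in.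
have right_val w :
    exists j : 'I_#|right_image f|, enum_val j = f (rshift m w).
  have wP : f (rshift m w) \in right_image f by apply: imset_f.
  by exists (enum_rank_in wP (f (rshift m w))); rewrite enum_rankK_in.
have [g1 g1E] := fin_all_exists left_val.
have [g2 g2E] := fin_all_exists right_val.
exists (finfun g1, finfun g2); apply/ffunP => x.
by case: (split_ordP x) => v ->; rewrite ?gluel ?gluer /= ffunE.
Qed.

Lemma card_right_image A : leaf_closed G A ->
  #|[set f in forest_bij (forest_mul F1 F2) G | right_image f == A]| =
  (#|forest_bij F1 (subforest G (~: A))| * #|forest_bij F2 (subforest G A)|)%N.
Proof.
move=> closedA; rewrite -cardsX -(card_imset _ (@glue_inj A)).
apply: eq_card => f; rewrite inE; apply/andP/imsetP.
  case=> fS /eqP fA; have /mulP[injf _ _ _] := fS.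
  have [g fE] := glue_onto injf; rewrite {}fA in g fE.
  by exists g; rewrite // inE -mem_glue // -fE.
case=> g; rewrite inE => gS ->; rewrite mem_glue // gS; split=> //.
by apply/eqP/right_image_glue; case/andP: gS.
Qed.

Lemma card_forest_bij_mul :
  #|forest_bij (forest_mul F1 F2) G| =
  (\sum_(c | admissible G c)
     #|forest_bij F1 (Roo G c)| * #|forest_bij F2 (Lea G c)|)%N.
Proof.
(* The bijections are sorted by the cut they induce. Since [tops] and [leaves_part] are mutually
   inverse, the fibre over [c] consists of those whose right image is the leaf part of [c]. *)
pose cut f := tops G (right_image f).
rewrite -sum1_card (partition_big cut (admissible G)); last first.
  by move=> f _; apply: admissible_tops.
apply: eq_bigr => c adm; rewrite -card_right_image; last first.
  exact: leaves_part_closed.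
rewrite -sum1_card; apply: eq_bigl => f; rewrite inE.
apply: andb_id2l => /right_image_closed closedf; rewrite /cut.
by apply/eqP/eqP => [<-|->]; rewrite ?topsK // leaves_partK.
Qed.

End CutDecomposition.

Local Open Scope ring_scope.

(** * Linear extension from basis elements, products and tensors *)

Section LinearExtension.
Variables (K : fieldType) (B : choiceType).
Implicit Types (phi : B -> K) (x y : {malg K[B]}).

(** Writing every form as an iterated [linext] reduces identities between forms to basis elements,
    through [eq_linext]. *)
Definition linext phi x : K := mmap idfun phi x.

Lemma linextE phi x : linext phi x = \sum_(b <- msupp x) x@_b * phi b.
Proof. exact: mmapE. Qed.

Lemma linext_scalar phi : scalar (linext phi).
Proof.
move=> c x y; rewrite /linext mmapD; congr (_ + _).
rewrite (mmapEw (msuppZ_le c x)) mmapE big_distrr /=.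
by apply: eq_bigr => b _; rewrite mcoeffZ mulrA.
Qed.

HB.instance Definition _ phi :=
  GRing.isLinear.Build K {malg K[B]} K *%R (linext phi) (linext_scalar phi).

Lemma linextU phi c b : linext phi << c *g b >> = c * phi b.
Proof. exact: mmapU. Qed.

Lemma eq_linext phi psi : phi =1 psi -> linext phi =1 linext psi.
Proof. by move=> e x; rewrite !linextE; apply: eq_bigr => b _; rewrite e. Qed.

End LinearExtension.

(** Exchanging the two finite sums lets a bilinear expression be expanded in either argument
    first. *)
Lemma linextC (K : fieldType) (B B' : choiceType) (phi : B -> B' -> K) x y :
  linext (fun a => linext (phi a) y) x = linext (fun b => linext (phi^~ b) x) y.
Proof.
rewrite !linextE; under eq_bigr do rewrite linextE big_distrr /=.
under [RHS]eq_bigr do rewrite linextE big_distrr /=.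
rewrite exchange_big; apply: eq_bigr => b _; apply: eq_bigr => a _.
by rewrite mulrCA.
Qed.

Section Tensors.
Variables (K : fieldType) (B : choiceType).
Implicit Types (x y : {malg K[B]}) (u v : {malg K[(B * B)%type]}).

Lemma linext_tens phi x y :
  linext phi (tens x y) = linext (fun a => linext (fun b => phi (a, b)) y) x.
Proof.
rewrite [RHS]linextE raddf_sum; apply: eq_bigr => a _.
rewrite linextE raddf_sum big_distrr; apply: eq_bigr => b _.
by rewrite /= linextU mulrA.
Qed.

Lemma linext_swap phi u :
  linext phi (tens_swap u) = linext (fun ab => phi (ab.2, ab.1)) u.
Proof.
rewrite [RHS]linextE raddf_sum; apply: eq_bigr => ab _.
by rewrite /= linextU.
Qed.

Lemma tens_pairingE p u v : tens_pairing p u v =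
  linext (fun ab => linext (fun cd =>
    p << ab.1 >> << cd.1 >> * p << ab.2 >> << cd.2 >>) v) u.
Proof.
rewrite linextE; apply: eq_bigr => ab _; rewrite linextE big_distrr.
by apply: eq_bigr => cd _; rewrite -!mulrA.
Qed.

Lemma tens_pairingC p u v :
  symmetric_pairing p -> tens_pairing p u v = tens_pairing p v u.
Proof.
move=> symp; rewrite !tens_pairingE linextC.
apply: eq_linext => ab; apply: eq_linext => cd.
by rewrite (symp << ab.1 >>) (symp << ab.2 >>).
Qed.

End Tensors.

Lemma linextM (K : fieldType) (B : monomType) (phi : B -> K)
    (x y : {malg K[B]}) :
  linext phi (x * y) = linext (fun a => linext (fun b => phi (mmul a b)) y) x.
Proof.
rewrite malgME [RHS]linextE raddf_sum; apply: eq_bigr => a _.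
rewrite linextE raddf_sum big_distrr; apply: eq_bigr => b _.
by rewrite /= linextU mulrA.
Qed.

(** * The pairing and its Hopf axioms *)

Section Pairing.
Variable K : fieldType.
Implicit Types (x y z : Ho K).

Lemma pairingE x y :
  pairing x y = linext (fun F => linext (fun G => #|forest_bij F G|%:R) y) x.
Proof.
rewrite linextE; apply: eq_bigr => F _; rewrite linextE big_distrr.
by apply: eq_bigr => G _; rewrite -!mulrA.
Qed.

Lemma pairingU F G : @pairing K << F >> << G >> = #|forest_bij F G|%:R.
Proof. by rewrite pairingE !linextU !mul1r. Qed.

Lemma linext_coprod_op phi x : linext phi (coprod_op x) =
  linext (fun F : ordered_forest =>
    \sum_(c | admissible F c) phi (Roo F c, Lea F c)) x.
Proof.
rewrite linext_swap [RHS]linextE raddf_sum; apply: eq_bigr => F _.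
rewrite /= linearZ /= raddf_sum; congr (_ * _); apply: eq_bigr => c _.
by rewrite /= linextU mul1r.
Qed.

Lemma pairing_bilinear : bilinear_form (@pairing K).
Proof.
split=> [x c y y'|y c x x']; rewrite !pairingE ?linearP //.
(* The second argument sits in the inner extension; [linextC] brings it outside, where linearity
   applies, and back. *)
by rewrite linextC linearP; rewrite linextC; congr (_ + _); rewrite linextC.
Qed.

Lemma pairing_sym : symmetric_pairing (@pairing K).
Proof.
move=> x y; rewrite !pairingE linextC; apply: eq_linext => G.
by apply: eq_linext => F; rewrite card_forest_bijC.
Qed.

(** On basis forests this is the image in [K] of the counting identity [card_forest_bij_mul]; the
    opposite coproduct puts the root part first, facing [F1]. *)
Lemma pairing_mull x y z :
  pairing (x * y) z = tens_pairing (@pairing K) (tens x y) (coprod_op z).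
Proof.
rewrite pairingE linextM tens_pairingE linext_tens.
apply: eq_linext => F1; apply: eq_linext => F2; rewrite linext_coprod_op.
apply: eq_linext => G; rewrite card_forest_bij_mul natr_sum.
by apply: eq_bigr => c _; rewrite natrM !pairingU.
Qed.

Lemma pairing_mulr x y z :
  pairing x (y * z) = tens_pairing (@pairing K) (coprod_op x) (tens y z).
Proof.
by rewrite pairing_sym pairing_mull tens_pairingC //; apply: pairing_sym.
Qed.

Lemma card_forest_bij1 F : #|forest_bij forest_one F| = (F == forest_one).
Proof.
case: eqP => [->|F1]; last first.
  apply: eq_card0 => f; apply/negP => /forest_bij_degree e.
  by apply: F1; apply: degree_eq0.
apply/eqP/cards1P; exists [ffun i => i]; apply/setP => f; rewrite in_set1.
(* There is a single map from ['I_0], and all its conditions hold vacuously. *)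
have -> : f = [ffun i => i] by apply/ffunP; case.
by rewrite eqxx; apply/forest_bijP; split; case.
Qed.

Lemma pairing1 x : pairing 1 x = counit x.
Proof.
rewrite pairingE linextU mul1r linextE /counit.
(* Expanding [x] on the right only turns its coefficient at the empty forest into a sum of Kronecker
   deltas, compared termwise. *)
rewrite [in RHS](monalgE x) raddf_sum; apply: eq_bigr => F _.
by rewrite /= mcoeffU card_forest_bij1 mulr_natr.
Qed.

Lemma pairing_homogeneous : homogeneous_degree0 degree (@pairing K).
Proof.
move=> d e x y xd ye de; rewrite /pairing big_seq big1 // => F /xd Fd.
rewrite big_seq big1 // => G /ye Ge; rewrite [#|_|]eq_card0 ?mulr0 // => f.
by apply/negP => /forest_bij_degree; rewrite Fd Ge.
Qed.

End Pairing.

Theorem theorem9 (K : fieldType) :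
  [/\ hopf_pairing (@coprod_op K) (@counit K) (@pairing K),
      symmetric_pairing (@pairing K) &
      homogeneous_degree0 degree (@pairing K)].
Proof.
split; [split | exact: pairing_sym | exact: pairing_homogeneous].
- exact: pairing_bilinear.
- exact: pairing_mull.
- exact: pairing_mulr.
- by move=> x; rewrite (pairing_sym x) !pairing1.
Qed.
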